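(* Let $p_0\in(0,1)$, let $G$ be a probability distribution on $[0,1]$, and consider the one-sided all-accept verification cascade with prior $p_0$ and latent false-accept distribution $G$ (as described in the context). For every integer $k\ge 0$ put $m_k=\mathbb{E}_{\alpha\sim G}[\alpha^k]$. Then for every integer $k\ge 0$, $$\ell_k=\ell_0-\ln m_k,\qquad r_k=\frac{p_0}{p_0+(1-p_0)\,m_k},$$ and $r_k$ is nondecreasing in $k$.
   Context: One-sided all-accept cascade: a candidate answer has a random truth label $C\in\{0,1\}$ with $\mathbb{P}(C=1)=p_0$. It is passed through $k$ gates, each returning a verdict accept or reject. Given $C=1$, every gate accepts with probability $1$. Given $C=0$, a latent variable $\alpha$ is drawn from $G$, and conditionally on $\alpha$ (and $C=0$) the $k$ verdicts are i.i.d., each being accept with probability $\alpha$. Define the survivor reliability $r_k=\mathbb{P}(C=1\mid \text{all } k \text{ gates accept})$ and the log-odds $\ell_k=\ln\frac{r_k}{1-r_k}$; in particular $\ell_0=\ln\frac{p_0}{1-p_0}$. Conventions: $0^0=1$, and if $m_k=0$ then $-\ln m_k=+\infty$ and $\ell_k=+\infty$. *)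

(* Defs.v *)
From HB Require Import structures.
From mathcomp Require Import all_boot all_order all_algebra.
From mathcomp Require Import all_classical all_reals all_analysis.

Set Implicit Arguments.
Unset Strict Implicit.
Unset Printing Implicit Defensive.

Import Order.TTheory GRing.Theory Num.Theory.

Local Open Scope classical_set_scope.
Local Open Scope ring_scope.
Local Open Scope ereal_scope.

Definition cond_prob (d : measure_display) (T : measurableType d) (R : realType)
    (P : probability T R) (A B : set T) : \bar R :=
  P (A `&` B) / P B.

(* Verdict [true] means "accept".  The field [verdict_law] is the disintegration
   of the joint law of (latent, verdicts) given C = 0: given latent = a, the
   verdicts are independent Bernoulli(a).  The latent variable is unconstrained
   on the event C = 1, where the model does not use it. *)
Record cascade (R : realType) (p0 : R) (G : probability R R) (k : nat) := Cascade {
  cdisp : measure_display ;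
  cspace : measurableType cdisp ;
  cprob : probability cspace R ;
  label : {RV cprob >-> bool} ;
  latent : {RV cprob >-> R} ;
  verdict : 'I_k -> {RV cprob >-> bool} ;
  label_prior : cprob [set w | label w = true] = p0%:E ;
  verdict_true : forall i : 'I_k,
    cond_prob cprob [set w | verdict i w = true] [set w | label w = true] = 1 ;
  latent_law : forall B : set R, measurable B ->
    cond_prob cprob [set w | B (latent w)] [set w | label w = false] = G B ;
  verdict_law : forall (B : set R) (v : 'I_k -> bool), measurable B ->
    cond_prob cprob
      [set w | B (latent w) /\ forall i, verdict i w = v i]
      [set w | label w = false] =
    \int[G]_(a in B) (\prod_(i < k) bernoulli_pmf a (v i))%:E }.

Arguments label {R p0 G k} X : rename.
Arguments latent {R p0 G k} X : rename.
Arguments verdict {R p0 G k} X i : rename.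

Definition all_accept (R : realType) (p0 : R) (G : probability R R) (k : nat)
    (X : cascade p0 G k) : set (cspace X) :=
  [set w | forall i, verdict X i w = true].
Arguments all_accept {R p0 G k} X.

Definition reliability (R : realType) (p0 : R) (G : probability R R) (k : nat)
    (X : cascade p0 G k) : \bar R :=
  cond_prob (cprob X) [set w | label X w = true] (all_accept X).

(* In \bar R, 0^-1 = +oo and lne +oo = +oo, so the log-odds of a reliability
   equal to 1 is +oo; likewise lne 0 = -oo. *)
Definition log_odds (R : realType) (p0 : R) (G : probability R R) (k : nat)
    (X : cascade p0 G k) : \bar R :=
  lne (reliability X / (1 - reliability X)).

Definition moment (R : realType) (G : probability R R) (k : nat) : \bar R :=
  'E_G[(fun a : R => a ^+ k)%R].

(* Main.v *)
(** Splitting the event "all k gates accept" along the truth label gives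
    probability [p0] on [C = 1] (a finite intersection of almost sure events)
    and [(1 - p0) m_k] on [C = 0] (the disintegration over the latent variable,
    with every verdict equal to accept).  Bayes' rule then yields [r_k], whose
    odds are [(p0 / (1 - p0)) / m_k].  Since [G] lives on [[0, 1]], the moments
    lie in [[0, 1]] and decrease with [k], so [r_k] increases. *)

Require Import Defs.
From HB Require Import structures.
From mathcomp Require Import all_boot all_order all_algebra.
From mathcomp Require Import all_classical all_reals all_analysis.
From mathcomp Require Import measurable_realfun ring.

Import Order.TTheory GRing.Theory Num.Theory.

Local Open Scope classical_set_scope.
Local Open Scope ring_scope.
Local Open Scope ereal_scope.

Section conditional_probability.
Context (d : measure_display) (T : measurableType d) (R : realType).
Variable P : probability T R.
Implicit Types A B : set T.

Lemma cond_probM A B : measurable B -> P B != 0 ->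
  P (A `&` B) = cond_prob P A B * P B.
Proof.
move=> mB PB0; have finB : P B \is a fin_num by exact: fin_num_measure.
by rewrite /cond_prob -muleA mulVe ?mule1.
Qed.

(** Each [B]\[A i] is null, and a finite union of null sets is null. This lets gates that accept
    almost surely one by one accept almost surely together. *)
Lemma probability_bigcap_setI (I : finType) (A : I -> set T) B :
  (forall i, measurable (A i)) -> measurable B ->
  (forall i, P (A i `&` B) = P B) ->
  P ((\bigcap_(i in setT) A i) `&` B) = P B.
Proof.
move=> mA mB PAB.
have mAi : measurable (\bigcap_(i in setT) A i).
  by apply: fin_bigcap_measurable => // i _; exact: mA.
rewrite setIC [RHS](measureDI _ mB mAi).
(* [P B] is now split along the intersection; only the part of [B] outside it has to vanish. *)
rewrite [X in _ = X + _](_ : _ = 0) ?add0e//; apply: measure_negligible.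
  exact: measurableD.
have : \forall x \ae P, forall i, B x -> A i x.
  apply: filter_forall => i; exists (B `\` A i); split.
  - exact: measurableD.
  - have := @measureD _ _ _ P _ _ mB (mA i).
    rewrite ltey_eq fin_num_measure// => -> //.
    by rewrite setIC [X in _ - X]PAB subee ?fin_num_measure.
  - by move=> x /= /not_implyP.
apply: negligibleS => x /= [Bx nAx] ABx.
by apply: nAx => i _; exact: ABx.
Qed.

End conditional_probability.

Section moments.
Context (R : realType) (G : probability R R).
Hypothesis G01 : G `[0%R, 1%R]%classic = 1.

Lemma measurable_EFin_exprn (k : nat) (D : set R) :
  measurable_fun D (fun a : R => (a ^+ k)%:E).
Proof. by apply/measurable_EFinP; exact: measurable_funX. Qed.

(** [G] is a law on all of [R], but the complement of the unit interval is [G]-null. On the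
    interval, powers are nonnegative and decrease with the exponent. *)
Lemma moment_itv (k : nat) :
  moment G k = \int[G]_(a in `[0%R, 1%R]) (a ^+ k)%:E.
Proof.
have G01C : G (~` `[0%R, 1%R]%classic) = 0.
  by rewrite probability_setC// G01 subee.
rewrite /moment unlock [RHS]integral_mkcond.
apply: ae_eq_integral => //.
- exact: measurable_EFin_exprn.
- apply/(measurable_restrictT _ _).1 => //; exact: measurable_EFin_exprn.
exists (~` `[0%R, 1%R]%classic); split.
- exact: measurableC.
- exact: G01C.
- move=> x /= /not_implyP[_]; apply: contra_not => x01.
  by rewrite patchE mem_set.
Qed.

Lemma moment0 : moment G 0 = 1.
Proof.
rewrite moment_itv; under eq_integral do rewrite expr0.
by rewrite integral_cst// mul1e.
Qed.

Lemma moment_ge0 (k : nat) : 0 <= moment G k.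
Proof.
rewrite moment_itv; apply: integral_ge0 => a /=.
by rewrite in_itv/= lee_fin => /andP[a0 _]; rewrite exprn_ge0.
Qed.

Lemma moment_le (j k : nat) : (j <= k)%N -> moment G k <= moment G j.
Proof.
move=> jk; rewrite !moment_itv; apply: ge0_le_integral => //.
- move=> a /=; rewrite in_itv/= lee_fin => /andP[a0 _]; exact: exprn_ge0.
- exact: measurable_EFin_exprn.
- exact: measurable_EFin_exprn.
move=> a /=; rewrite in_itv/= lee_fin => /andP[a0 a1].
by rewrite ler_wiXn2l.
Qed.

Lemma moment_fin_num (k : nat) : moment G k \is a fin_num.
Proof.
rewrite ge0_fin_numE ?moment_ge0// (le_lt_trans (moment_le 0 k _))//.
by rewrite moment0 ltry.
Qed.

End moments.

Section reliability.
Context (R : realType) (p0 : R) (G : probability R R) (k : nat).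
Hypothesis hp0 : (0 < p0 < 1)%R.
Variable X : cascade p0 G k.

Let P := cprob X.
Let correct := [set w | label X w = true].
Let incorrect := [set w | label X w = false].

Lemma measurable_label (b : bool) : measurable [set w | label X w = b].
Proof. exact: (@measurable_funPTI _ _ _ _ (label X) [set b]). Qed.

Lemma measurable_verdict (i : 'I_k) (b : bool) :
  measurable [set w | verdict X i w = b].
Proof. exact: (@measurable_funPTI _ _ _ _ (verdict X i) [set b]). Qed.

Lemma all_acceptE :
  all_accept X = \bigcap_(i in setT) [set w | verdict X i w = true].
Proof. by apply/seteqP; split => w /= h i; [move=> _|]; exact: h. Qed.

Lemma measurable_all_accept : measurable (all_accept X).
Proof.
rewrite all_acceptE; apply: fin_bigcap_measurable => // i _.
exact: measurable_verdict.
Qed.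

Lemma incorrectE : incorrect = ~` correct.
Proof.
by apply/seteqP; split => w; rewrite /incorrect /correct /=; case: (label X w).
Qed.

Lemma label_false_prob : P incorrect = (1 - p0)%:E.
Proof.
by rewrite incorrectE probability_setC ?label_prior//; exact: measurable_label.
Qed.

Lemma correct_all_accept_prob : P (correct `&` all_accept X) = p0%:E.
Proof.
case/andP: hp0 => p0_gt0 _.
rewrite setIC all_acceptE probability_bigcap_setI ?label_prior//.
- by move=> i; exact: measurable_verdict.
- exact: measurable_label.
move=> i; rewrite cond_probM.
- by rewrite verdict_true mul1e label_prior.
- exact: measurable_label.
- by rewrite label_prior eqe gt_eqF.
Qed.

Lemma incorrect_all_accept_prob :
  P (incorrect `&` all_accept X) = (1 - p0)%:E * moment G k.
Proof.
case/andP: hp0 => _ p0_lt1.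
rewrite setIC cond_probM; last 2 first.
- exact: measurable_label.
- by rewrite label_false_prob eqe subr_eq0 gt_eqF.
rewrite label_false_prob muleC; congr (_ * _).
rewrite /moment unlock.
(* Instantiating [verdict_law] with no constraint on the latent variable and all verdicts [true]
   turns the product into [a ^+ k]. *)
have -> : all_accept X =
    [set w | setT (latent X w) /\ forall i, verdict X i w = true].
  by apply/seteqP; split => w //= [].
rewrite (@verdict_law _ _ _ _ X setT (fun=> true))//; apply: eq_integral => a _.
by rewrite prodr_const card_ord.
Qed.

Lemma reliabilityE :
  reliability X = p0%:E / (p0%:E + (1 - p0)%:E * moment G k).
Proof.
rewrite /reliability /cond_prob correct_all_accept_prob; congr (_ / _).
(* The denominator is the law of total probability over the label. *)
rewrite -incorrect_all_accept_prob -correct_all_accept_prob addeC.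
rewrite ![_ `&` all_accept X]setIC.
rewrite incorrectE -setDE.
exact: (measureDI P measurable_all_accept (measurable_label true)).
Qed.

Lemma log_oddsE : G `[0%R, 1%R]%classic = 1 ->
  log_odds X = (ln (p0 / (1 - p0)))%:E - lne (moment G k).
Proof.
move=> G01; case/andP: hp0 => p0_gt0 p0_lt1.
have q_gt0 : (0 < 1 - p0)%R by rewrite subr_gt0.
rewrite /log_odds reliabilityE.
have := @moment_ge0 R G G01 k; have := @moment_fin_num R G G01 k.
(* If [m = 0], the reliability is 1 and both sides are [+oo]; otherwise everything is a positive
   real. *)
case: (moment G k) => // m _; rewrite lee_fin le_eqVlt => /predU1P[<-|m_gt0].
  rewrite mule0 adde0 divee ?eqe ?gt_eqF// subee// inve0 mul1e.
  by rewrite /= lexx.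
have D_gt0 : (0 < p0 + (1 - p0) * m)%R by rewrite addr_gt0 ?mulr_gt0.
have qm_gt0 : (0 < (1 - p0) * m)%R by rewrite mulr_gt0.
rewrite -EFinM -EFinD inver gt_eqF// -EFinM -EFinB.
(* Over the common denominator, the odds simplify to [p0 / ((1 - p0) * m)]. *)
have -> : (1 - p0 / (p0 + (1 - p0) * m) =
    (1 - p0) * m / (p0 + (1 - p0) * m))%R.
  by field; rewrite gt_eqF.
rewrite inver gt_eqF ?divr_gt0// -EFinM !lne_EFin//; last first.
  by rewrite !divr_gt0.
rewrite -EFinB -ln_div ?posrE ?divr_gt0//; congr (ln _)%:E.
by field; rewrite !gt_eqF.
Qed.

End reliability.

Theorem proposition3p1 (R : realType) (p0 : R) (G : probability R R)
    (hp0 : (0 < p0 < 1)%R) (hG : G `[0%R, 1%R]%classic = 1)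
    (X : forall k : nat, cascade p0 G k) :
  (forall k : nat,
     log_odds (X k) = log_odds (X 0%N) - lne (moment G k) /\
     reliability (X k) = p0%:E / (p0%:E + (1 - p0)%:E * moment G k)) /\
  (forall j k : nat, (j <= k)%N -> reliability (X j) <= reliability (X k)).
Proof.
have /andP[p0_gt0 p0_lt1] := hp0.
split=> [k|j k jk].
  (* Since the zeroth moment is 1, [log_odds (X 0%N)] is the prior log-odds. *)
  by rewrite !log_oddsE// moment0// lne1 sube0; split=> //; exact: reliabilityE.
have q_ge0 : 0 <= (1 - p0)%:E by rewrite lee_fin subr_ge0 ltW.
have D_ge0 i : 0 <= p0%:E + (1 - p0)%:E * moment G i.
  by rewrite adde_ge0 ?mule_ge0 ?moment_ge0// lee_fin ltW.
(* [X j] and [X k] may live on unrelated spaces, so their events cannot be compared; the closed form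
   reduces the claim to antitonicity of the inverse and of the moments. *)
rewrite !reliabilityE// lee_pmul2l// lee_pV2 ?inE ?D_ge0//.
by rewrite leeD2l// lee_wpmul2l// moment_le.
Qed.
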